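(* Let $\Gamma=(V,E)$ be a finite undirected graph. The following conditions are equivalent: (i) there exist a function $F:\mathbb{N}\to\mathbb{N}$ and an integer $\ell>1$ such that, for all $k_1,\ldots,k_\ell\in\mathbb{N}$, $\lambda_{k_1,\ldots,k_\ell}(\Gamma)\le F(k_1)$; (ii) there exist a function $F:\mathbb{N}\to\mathbb{N}$ and an integer $\ell>1$ such that, for all $k_1,\ldots,k_\ell\in\mathbb{N}$, $\lambda_{k_1,\ldots,k_\ell}(\Gamma)= F(k_1)$; (iii) $\Gamma$ is a disjoint union of complete graphs, i.e. any two distinct vertices lying in the same connected component of $\Gamma$ are adjacent.
   Context: $\mathbb{N}$ denotes the set of positive integers. A graph is a finite directed graph without multiple edges, possibly with loops; a graph $(V,E)$ is undirected if $(u,v)\in E$ implies $(v,u)\in E$. For an undirected graph, $d(u,v)$ is the usual path distance. Given $k_1,\ldots,k_\ell\in\mathbb{N}$, an $L(k_1,\ldots,k_\ell)$-labelling of an undirected graph $\Gamma=(V,E)$ is a map $f:V\to\mathbb{N}$ such that $|f(u)-f(v)|\ge k_t$ whenever $d(u,v)=t$, for $t=1,\ldots,\ell$. The span of $f$ is the difference between its largest and smallest values, and $\lambda_{k_1,\ldots,k_\ell}(\Gamma)$ is the minimum span over all $L(k_1,\ldots,k_\ell)$-labellings of $\Gamma$.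
   Formalization: The function F is allowed to take the value 0, since for a graph with no edges between distinct vertices the minimum span is 0, so (ii) would fail with F valued in the positive integers although (i) and (iii) hold. *)

(* Defs.v *)
From mathcomp Require Import all_boot all_order all_algebra.
From mathcomp Require Import boolp.

Set Implicit Arguments.
Unset Strict Implicit.
Unset Printing Implicit Defensive.

(* A graph is an edge relation [e] on a finite type; loops are allowed, and
   [symmetric e] says that it is undirected. *)

Definition walk (V : finType) (e : rel V) (t : nat) (u v : V) : bool :=
  [exists p : t.-tuple V, path e u p && (last u p == v)].

(* d(u,v) = t; holds for no t when u and v are in different components. *)
Definition dist_is (V : finType) (e : rel V) (u v : V) (t : nat) : bool :=
  walk e t u v && [forall s : 'I_t, ~~ walk e s u v].

(* The tuple [k] is indexed from 0: [tnth k i] is k_(i+1).  The difference inside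
   [`|f u - f v|] is taken in [int], not truncated. *)
Definition labelling (V : finType) (e : rel V) (l : nat) (k : l.-tuple nat)
    (f : V -> nat) : Prop :=
  (forall v, 0 < f v) /\
  (forall (i : 'I_l) (u v : V),
     dist_is e u v i.+1 -> tnth k i <= `|f u - f v|%N).

(* Starting the minimum from the maximum does not change it when V is nonempty,
   and gives span 0 when V is empty. *)
Definition span (V : finType) (f : V -> nat) : nat :=
  \max_(v : V) f v - \big[minn / \max_(v : V) f v]_(v : V) f v.

Definition labelling_span (V : finType) (e : rel V) (l : nat)
    (k : l.-tuple nat) (n : nat) : Prop :=
  exists2 f : V -> nat, labelling e k f & span f = n.

Lemma dist_is_neq (V : finType) (e : rel V) (u v : V) (t : nat) :
  dist_is e u v t.+1 -> u != v.
Proof.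
move=> /andP[_ /forallP/(_ ord0)]; apply: contra => /eqP <-.
by apply/existsP; exists [tuple]; rewrite /= eqxx.
Qed.

Lemma labelling_span_ex (V : finType) (e : rel V) (l : nat)
    (k : l.-tuple nat) : exists n, `[< labelling_span e k n >].
Proof.
pose K := \max_(i < l) tnth k i.
pose f (v : V) := (enum_rank v * K).+1.
exists (span f); apply/asboolP; exists f => //; split=> // i u v /dist_is_neq uv.
have Kr : tnth k i <= K by exact: (leq_bigmax i).
apply: leq_trans Kr _.
have ruv : enum_rank u != enum_rank v :> nat.
  by apply: contra uv => /eqP/val_inj/enum_rank_inj ->.
have le_dist (a b : nat) : a < b -> K <= `|(a * K).+1 - (b * K).+1|%N.
  move=> ltab; rewrite distnEr ?ltnS ?leq_mul2r ?(ltnW ltab) ?orbT //.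
  by rewrite subSS -mulnBl leq_pmull // subn_gt0.
rewrite /f; case: (ltngtP (enum_rank u) (enum_rank v)) ruv => // ruv _.
  exact: le_dist.
by rewrite distnC; exact: le_dist.
Qed.

(* lambda_{k_1,...,k_l}, the least span of a labelling.  It can be 0 (edgeless
   graphs), although labels are positive. *)
Definition lambda (V : finType) (e : rel V) (l : nat) (k : l.-tuple nat) : nat :=
  ex_minn (labelling_span_ex e k).

(* Main.v *)
Require Import Defs.
From mathcomp Require Import all_boot.
From mathcomp Require Import ssrint boolp.

(* If two vertices at distance 2 exist, letting k_2 grow with k_1 = 1 fixed makes
   the span unbounded.  Hence a bound F(k_1) forces adjacency-or-equality to be
   transitive, so components are complete.  Conversely, when components are
   complete no two vertices are at distance 2, so with l = 2 only k_1 matters. *)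

Lemma distn_le_span (V : finType) (f : V -> nat) (u v : V) :
  `|f u - f v|%N <= span f.
Proof.
have min_le (w : V) : \big[minn / \max_x f x]_x f x <= f w.
  (* The starting value is itself a maximum over the enumeration, so it is generalised to an
     arbitrary [m] before the induction on the list. *)
  elim: (index_enum V) (mem_index_enum w) (\max_x f x) => // x r IHr w_xr m.
  rewrite big_cons geq_min; move: w_xr; rewrite inE.
  by case/predU1P=> [->|/IHr->]; rewrite ?leqnn ?orbT.
wlog le_uv : u v / f u <= f v.
  by move=> H; case/orP: (leq_total (f u) (f v)) => /H //; rewrite distnC.
by rewrite distnEr // leq_sub // (leq_bigmax v).
Qed.

Lemma dist_is2 (V : finType) (e : rel V) (u v w : V) :
  e u w -> e w v -> u != v -> ~~ e u v -> dist_is e u v 2.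
Proof.
move=> uw wv neq_uv nuv; apply/andP; split.
  by apply/existsP; exists [tuple w; v]; rewrite /= uw wv eqxx.
(* Shorter walks have length 0, which would give [u = v], or length 1, which would give [e u v]. *)
apply/forallP => -[[|[|//]] lt_s]; apply/existsPn => p.
  by rewrite tuple0 /=.
case/tupleP: p => x p; rewrite tuple0 /= andbT.
by apply: contra nuv => /andP[ux /eqP<-].
Qed.

Lemma dist_is2_connect (V : finType) (e : rel V) (u v : V) :
  dist_is e u v 2 -> connect e u v && ~~ e u v.
Proof.
case/andP=> /existsP[p /andP[up /eqP lp]] /forallP/(_ (Ordinal (isT : 1 < 2))).
move=> /existsPn/(_ [tuple v]); rewrite /= eqxx !andbT => ->.
by rewrite andbT; apply/connectP; exists p.
Qed.

Lemma eq_lambda (V : finType) (e : rel V) (l : nat) (k k' : l.-tuple nat) :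
  (forall f, labelling e k f <-> labelling e k' f) -> lambda e k = lambda e k'.
Proof.
move=> kk'; apply: eq_ex_minn => n; apply: asbool_equiv_eq.
by split=> -[f /kk' kf sf]; exists f.
Qed.

Lemma bounded_lambda_complete (V : finType) (e : rel V) (l : nat)
    (F : nat -> nat) :
  1 < l ->
  (forall k : l.-tuple nat, (forall i, 0 < tnth k i) ->
     lambda e k <= F (nth 0 k 0)) ->
  forall u v : V, connect e u v -> u != v -> e u v.
Proof.
move=> lt1l bound.
have e_trans (u v w : V) : e u w -> e w v -> u != v -> e u v.
  move=> uw wv neq_uv; apply/negPn/negP => nuv.
  (* Positions count from 0, so [i == 1] is k_2. A pair at distance 2 forces a span of at least k_2
     = F(1) + 1, above the bound F(k_1) = F(1). *)
  pose k := [tuple if i == 1 :> nat then (F 1).+1 else 1 | i < l].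
  have k_gt0 i : 0 < tnth k i by rewrite tnth_mktuple; case: ifP.
  have := bound k k_gt0.
  have -> : nth 0 k 0 = 1.
    by rewrite -(tnth_nth 0 k (Ordinal (ltnW lt1l))) tnth_mktuple.
  rewrite /lambda; case: ex_minnP => n /asboolP[f [_ fk] <-] _.
  have /(fk (Ordinal lt1l)) := dist_is2 _ _ _ _ _ uw wv neq_uv nuv.
  rewrite tnth_mktuple /= => /leq_trans/(_ (distn_le_span _ f u v)) lt_F.
  by rewrite leqNgt lt_F.
(* The tail of the path gives [w = v] or an edge from [w] to [v]; in the latter case [e_trans]
   absorbs the first edge. *)
move=> u v /connectP[p]; elim: p u => [|w p IHp] u /= => [_ ->|].
  by rewrite eqxx.
case/andP=> uw wp vE; have [<-//|neq_wv] := eqVneq w v.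
exact: (e_trans _ _ w uw (IHp w wp vE neq_wv)).
Qed.

Lemma complete_lambda_eq (V : finType) (e : rel V) (k k' : 2.-tuple nat) :
  (forall u v : V, connect e u v -> u != v -> e u v) ->
  nth 0 k 0 = nth 0 k' 0 -> lambda e k = lambda e k'.
Proof.
move=> complete kk'; apply: eq_lambda => f.
(* The condition on k_2 is vacuous: a pair at distance 2 is connected, distinct and non-adjacent,
   against [complete]. *)
have labE (h : 2.-tuple nat) : labelling e h f <-> (forall v, 0 < f v) /\
    (forall u v, dist_is e u v 1 -> nth 0 h 0 <= `|f u - f v|%N).
  split=> -[f_gt0 hf]; split=> //.
    by move=> u v /(hf ord0); rewrite (tnth_nth 0).
  case=> [[|[|//]] lt_i] u v; rewrite (tnth_nth 0) /=; first exact: hf.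
  move=> uv; have neq_uv := dist_is_neq uv.
  by have /andP[/complete/(_ neq_uv)->] := dist_is2_connect _ _ _ _ uv.
by apply: iff_trans (labE k) _; rewrite kk'; apply: iff_sym.
Qed.

Theorem theorem4 (V : finType) (e : rel V) (e_sym : symmetric e) :
  [<-> (* (i) *)
       exists (F : nat -> nat) (l : nat), 1 < l /\
         forall k : l.-tuple nat, (forall i, 0 < tnth k i) ->
           lambda e k <= F (nth 0 k 0);
       (* (ii) *)
       exists (F : nat -> nat) (l : nat), 1 < l /\
         forall k : l.-tuple nat, (forall i, 0 < tnth k i) ->
           lambda e k = F (nth 0 k 0);
       (* (iii) *)
       forall u v : V, connect e u v -> u != v -> e u v].
Proof.
tfae.
(* The passage from (i) to (ii) goes through (iii). The given [l] is replaced by 2, and the new F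
   takes the value of [lambda] at k_2 = 1, an arbitrary positive choice. *)
- case=> F [l [lt1l /(bounded_lambda_complete _ _ _ _ lt1l) complete]].
  exists (fun k1 => lambda e [tuple k1; 1]), 2; split=> // k _.
  exact: complete_lambda_eq.
- case=> F [l [lt1l lambdaE]]; apply: (bounded_lambda_complete _ _ l F lt1l).
  by move=> k /lambdaE->.
- move=> complete; exists (fun k1 => lambda e [tuple k1; 1]), 2; split=> // k _.
  by rewrite (complete_lambda_eq _ _ k [tuple nth 0 k 0; 1]).
Qed.
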